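(* Let $G\in\mathscr{G}_{a,b}$ and let $R=u_1u_2\cdots u_k$ be a path or a cycle (in the latter case $u_1=u_k$) of $G_0$ of length at least $3$ such that $d_{G_0}(u_1)=d_{G_0}(u_k)\in\{3,4\}$ and $d_{G_0}(u_i)=2$ for $2\leq i\leq k-1$. (i) If there is $i\in\{2,\ldots,k-2\}$ such that $d(u_i)\neq d(u_{i+1})$, then $l(R)=3$ and $b=1$; moreover, if $d_{G_0}(u_1)=3$, then $a=6$, $d(u_1)=d_{G_0}(u_1)=3$, and either $d(u_2)=2,\ d(u_3)=4$ or $d(u_2)=4,\ d(u_3)=2$; and if $d_{G_0}(u_1)=4$, then $a=7$, $d(u_1)=d_{G_0}(u_1)=4$, and either $d(u_2)=2,\ d(u_3)=5$ or $d(u_2)=5,\ d(u_3)=2$. (ii) If $d(u_2)=d(u_3)=\cdots=d(u_{k-1})=d$, then $d\in\{2,a-b-1\}$; moreover, if $R$ is a cycle, then $l(R)=3$ and $d(u_2)=d(u_3)=2$.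
   Context: Graphs are finite, simple and connected; $d(v)$ denotes the degree of $v$ in $G$ and $s(v)=\sum_{u\in N_G(v)}d(u)$. A graph $G$ is 2-walk $(a,b)$-parabolic if there exist uniquely a positive integer $a$ and a non-negative integer $b$ such that $a^2-8b>0$ and $s(v)=-d(v)^2+a\,d(v)-b$ for all $v\in V(G)$. A bicyclic graph is a simple connected graph with number of edges equal to number of vertices plus one. $\mathscr{G}_{a,b}$ is the set of 2-walk $(a,b)$-parabolic bicyclic graphs $G$ with minimum degree $\delta(G)=1$. For $G\in\mathscr{G}_{a,b}$, $G_0$ is the graph obtained from $G$ by deleting all pendant (degree-1) vertices, and $d_{G_0}(v)$ is the degree of $v$ in $G_0$. The length $l(R)$ of a path or cycle is its number of edges. *)

(* Defs.v *)
From HB Require Import structures.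
From mathcomp Require Import all_boot all_order all_algebra.
Set Implicit Arguments.
Unset Strict Implicit.
Unset Printing Implicit Defensive.

Record sgraph := SGraph {
  vertex :> finType;
  adj : rel vertex;
  adj_sym : symmetric adj;
  adj_irr : irreflexive adj }.

Definition deg (G : sgraph) (v : G) : nat := #|[set u | adj v u]|.

Definition nbr_deg_sum (G : sgraph) (v : G) : nat := \sum_(u | adj v u) deg u.

Definition edges (G : sgraph) : {set {set G}} :=
  [set [set p.1; p.2] | p : G * G & adj p.1 p.2].

Definition connected (G : sgraph) : Prop :=
  0 < #|G| /\ forall x y : G, connect (@adj G) x y.

Definition bicyclic (G : sgraph) : Prop :=
  connected G /\ #|edges G| = #|G| + 1.

Definition is_min_degree (G : sgraph) (m : nat) : Prop :=
  (exists v : G, deg v = m) /\ forall v : G, m <= deg v.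

Definition parabolic_eq (G : sgraph) (a b : nat) : Prop :=
  [/\ 0 < a, (0 < a%:Z ^+ 2 - 8%:Z * b%:Z)%R &
      forall v : G, ((nbr_deg_sum v)%:Z
                     = - (deg v)%:Z ^+ 2 + a%:Z * (deg v)%:Z - b%:Z)%R].

Definition parabolic (G : sgraph) (a b : nat) : Prop :=
  parabolic_eq G a b /\
  forall a' b' : nat, parabolic_eq G a' b' -> a' = a /\ b' = b.

(* The class written \mathscr{G}_{a,b}. *)
Definition parabolic_bicyclic (G : sgraph) (a b : nat) : Prop :=
  [/\ bicyclic G, parabolic G a b & is_min_degree G 1].

Definition induced_adj (G : sgraph) (S : {set G}) : rel {x : G | x \in S} :=
  fun x y => adj (val x) (val y).

Lemma induced_sym (G : sgraph) (S : {set G}) : symmetric (@induced_adj G S).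
Proof. by move=> x y; apply: adj_sym. Qed.

Lemma induced_irr (G : sgraph) (S : {set G}) : irreflexive (@induced_adj G S).
Proof. by move=> x; apply: adj_irr. Qed.

Definition induced (G : sgraph) (S : {set G}) : sgraph :=
  SGraph (@induced_sym G S) (@induced_irr G S).

Definition del_pendant (G : sgraph) : sgraph := induced [set v : G | deg v != 1].

(* Embedding of the vertices of G_0 into those of G: [deg v] is d_{G_0}(v),
   [deg (emb v)] is d(v). *)
Definition emb (G : sgraph) (v : del_pendant G) : G := val v.

Definition is_path (G : sgraph) (R : seq G) : bool :=
  if R is x :: p then path (@adj G) x p && uniq R else false.

(* A cycle is listed with its first vertex repeated at the end. *)
Definition is_cycle (G : sgraph) (R : seq G) : bool :=
  if R is x :: p
  then [&& path (@adj G) x p, last x p == x, uniq p & 3 <= size p] else false.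

(* Number of edges of a path or cycle listed as above. *)
Definition walk_length (G : sgraph) (R : seq G) : nat := (size R).-1.

(* Main.v *)
Require Import Defs.
From HB Require Import structures.
From mathcomp Require Import all_boot all_order all_algebra.
From mathcomp Require Import zify.
Set Implicit Arguments.
Unset Strict Implicit.
Unset Printing Implicit Defensive.

(** The neighbour of a pendant vertex has degree [c = a - b - 1], so every
    vertex [v] of [G_0] satisfies [d(v) = d_{G_0}(v)] or [d(v) = c].  Hence a
    vertex of degree 2 in [G_0] has [d(v) = 2] or [d(v) = c], and the degrees of
    its two neighbours in [G_0] add up to [2a - b - 4] or [b(c - 1) + 2]
    respectively.  Along [R] this recurrence, together with the fact that an end
    of [R] has only neighbours of degree at least 2 in [G_0], leaves only the
    listed possibilities. *)

(** * Weighted sums over a neighbourhood *)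

Lemma sum_nbr_two_le (H : sgraph) (f : H -> nat) (v x y : H) :
  (forall z, 2 <= f z) -> adj v x -> adj v y -> x != y ->
  f x + f y + 2 * (deg v - 2) <= \sum_(z | adj v z) f z.
Proof.
move=> f2 vx vy xy.
have vy' : adj v y && (y != x) by rewrite vy eq_sym xy.
rewrite (bigD1 x) //= (bigD1 y) //= addnA leq_add2l.
have -> : deg v - 2 = \sum_(z | adj v z && (z != x) && (z != y)) 1.
  rewrite /deg cardsE -sum1_card (bigD1 x) //= (bigD1 y) //= addnA addKn.
  exact: eq_bigl.
by rewrite big_distrr /=; apply: leq_sum => z _; rewrite muln1.
Qed.

Lemma sum_nbr_ge (H : sgraph) (f : H -> nat) (v : H) :
  (forall z, 2 <= f z) -> 2 * deg v <= \sum_(z | adj v z) f z.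
Proof.
move=> f2; rewrite /deg cardsE -sum1_card big_distrr /=.
by apply: leq_sum => z _; rewrite muln1.
Qed.

Lemma sum_nbr_deg2 (H : sgraph) (f : H -> nat) (v x y : H) :
  deg v = 2 -> adj v x -> adj v y -> x != y ->
  \sum_(z | adj v z) f z = f x + f y.
Proof.
move=> dv vx vy xy.
have vy' : adj v y && (y != x) by rewrite vy eq_sym xy.
rewrite (bigD1 x) //= (bigD1 y) //= addnA [X in _ + X]big_pred0 ?addn0 // => z.
apply/negP => /andP[/andP[vz zx] zy].
(* A third neighbour [z] would push this count above 2. *)
have : \sum_(w | adj v w) 1 = 2 by rewrite sum1_card -[RHS]dv /deg cardsE.
rewrite (bigD1 x) //= (bigD1 y) //= (bigD1 z) ?vz ?zx ?zy //=.
Qed.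

Lemma pendant_nbr_deg_sum (G : sgraph) (v w : G) :
  deg w = 1 -> adj w v -> nbr_deg_sum w = deg v.
Proof.
move=> /eqP/cards1P[x wx] wv.
have : v \in [set z | adj w z] by rewrite inE.
rewrite wx inE => /eqP ->; apply: big_pred1 => z.
by move/setP/(_ z): wx; rewrite !inE.
Qed.

(** * The parabolic equation read on [G_0] *)

Section Reduced.
Variables (G : sgraph) (a b : nat).
Hypothesis HG : parabolic_bicyclic G a b.

Lemma emb_deg_ge2 (v : del_pendant G) : 2 <= deg (emb v).
Proof.
case: HG => _ _ [_ /(_ (emb v))].
have := valP v; rewrite inE /emb; lia.
Qed.

(** Each pendant neighbour of [v] adds 1 to its degree and 1 to [nbr_deg_sum]; the parabolic
    equation at such a neighbour fixes [deg (emb v)]. *)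
Lemma emb_balance (v : del_pendant G) : exists p,
  [/\ deg (emb v) = deg v + p,
      0 < p -> deg (emb v) + b + 1 = a &
      \sum_(z | adj v z) deg (emb z) + p + deg (emb v) ^ 2 + b =
        a * deg (emb v)].
Proof.
case: HG => _ [[_ _ par] _] _.
pose P := [pred z : G | adj (emb v) z].
pose Q := [pred z : G | deg z != 1].
have split_sum (f : G -> nat) : \sum_(z | P z) f z =
    \sum_(z : del_pendant G | adj v z) f (emb z) + \sum_(z | P z && ~~ Q z) f z.
  rewrite (bigID Q) /=; congr (_ + _).
  rewrite (eq_bigl (fun z => (z \in [set z | deg z != 1]) && adj (emb v) z));
    last by move=> z; rewrite inE andbC.
  by rewrite big_sub_cond.
(* The number of pendant neighbours, as a sum of ones so that [split_sum] applies. *)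
exists (\sum_(z | P z && ~~ Q z) 1); split.
- rewrite /deg !cardsE -!sum1_card; exact: split_sum.
- rewrite sum1_card => /card_gt0P[w]; rewrite unfold_in /= negbK => /andP[vw /eqP w1].
  have := par w; rewrite (@pendant_nbr_deg_sum _ (emb v)) 1?adj_sym // w1; lia.
- have -> : \sum_(z | P z && ~~ Q z) 1 = \sum_(z | P z && ~~ Q z) deg z.
    by apply: eq_bigr => z /andP[_]; rewrite negbK => /eqP.
  have := par (emb v); rewrite /nbr_deg_sum (split_sum (@deg G)) /=; lia.
Qed.

(** The cases are [p = 0] and [0 < p]; in the latter, substituting for [a] and [p] cancels the
    square. *)
Lemma emb_balance_deg2 (v x y : del_pendant G) :
  deg v = 2 -> adj v x -> adj v y -> x != y ->
  deg (emb v) = 2 /\ deg (emb x) + deg (emb y) + b + 4 = 2 * a \/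
  2 < deg (emb v) /\ deg (emb v) + b + 1 = a /\
      deg (emb x) + deg (emb y) + b = b * deg (emb v) + 2.
Proof.
move=> dv vx vy xy; have [p [ep pa]] := emb_balance v.
rewrite (sum_nbr_deg2 _ dv vx vy xy).
have [p0|p0] : p = 0 \/ 0 < p by lia.
  by left; nia.
by move: (pa p0) => <- ?; right; nia.
Qed.

Lemma emb_balance_ge (v : del_pendant G) :
  [/\ deg v <= deg (emb v),
      deg v < deg (emb v) -> deg (emb v) + b + 1 = a &
      deg (emb v) = deg v -> 2 * deg v + deg v ^ 2 + b <= a * deg v].
Proof.
have [p [ep pa sp]] := emb_balance v.
have := sum_nbr_ge v emb_deg_ge2.
by split; [lia | move=> ?; apply: pa; lia | nia].
Qed.

(* [c = d(v)] and [b = 2] would force the remaining neighbours of [v] in [G_0]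
   to have degree sum [d_{G_0}(v) - 2], but each has degree at least 2. *)
Lemma no_two_nbrs_same_deg (v x y : del_pendant G) :
  2 < deg v -> adj v x -> adj v y -> x != y -> b = 2 ->
  deg (emb v) + b + 1 = a -> deg (emb x) = deg (emb v) ->
  deg (emb y) = deg (emb v) -> False.
Proof.
move=> dv vx vy xy b2 ea ex ey.
have [p [ep _ sp]] := emb_balance v.
have := sum_nbr_two_le emb_deg_ge2 vx vy xy; nia.
Qed.

End Reduced.

(** * Degree jumps along an abstract sequence *)

Section Profile.
Variables (a b k d0 : nat) (D : nat -> nat).
Hypothesis k4 : 4 <= k.
Hypothesis d034 : d0 = 3 \/ d0 = 4.
Hypothesis D2 : forall i, 1 <= i <= k -> 2 <= D i.
Hypothesis Dint : forall i, 1 < i < k ->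
  D i = 2 /\ D i.-1 + D i.+1 + b + 4 = 2 * a \/
  2 < D i /\ D i + b + 1 = a /\ D i.-1 + D i.+1 + b = b * D i + 2.
Hypothesis Dend : forall i, i = 1 \/ i = k ->
  [/\ d0 <= D i, d0 < D i -> D i + b + 1 = a &
      D i = d0 -> 2 * d0 + d0 ^ 2 + b <= a * d0].

(** With [c = D i.+1], the balances at [i] and [i.+1] give [D i.-1 = c + b - 2] and
    [D i.+2 = b * (c - 1)]. Interior terms are 2 or [c], end terms [d0] or [c]; this forces [b = 1],
    and then both values are [c - 1]. [D] is arbitrary so that the reversed walk is covered too. *)
Lemma profile_jump i : 1 < i -> i.+1 < k -> D i = 2 -> 2 < D i.+1 ->
  [/\ k = 4, b = 1 & a = d0 + 3] /\
  [/\ D 1 = d0, D k = d0, D 2 = 2 & D 3 = d0 + 1].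
Proof.
move=> i1 ik Di Di1.
have ex : D i.-1 + D i.+1 + b + 4 = 2 * a.
  by have := @Dint i; lia.
have [ea ey] : D i.+1 + b + 1 = a /\ D i + D i.+2 + b = b * D i.+1 + 2.
  by have /= := @Dint i.+1; lia.
have xcases : (i = 2 /\ D i.-1 = D 1) \/
    (2 < i /\ (D i.-1 = 2 \/ D i.-1 + b + 1 = a)).
  have [->|i2] : i = 2 \/ 2 < i by lia.
    by left.
  by right; have := @Dint i.-1; lia.
have ycases : (i.+2 = k /\ D i.+2 = D k) \/
    (i.+2 < k /\ (D i.+2 = 2 \/ D i.+2 + b + 1 = a)).
  have [->|i2] : i.+2 = k \/ i.+2 < k by lia.
    by left.
  by right; have := @Dint i.+2; lia.
have [e1 e1c e1d] := Dend (or_introl (erefl 1)).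
have [ek ekc ekd] := Dend (or_intror (erefl k)).
have yE : D i.+2 + b = b * D i.+1 by move: ey Di => /=; lia.
have xE : D i.-1 + 2 = D i.+1 + b by lia.
have b1 : b = 1.
  have [|[|[|]]] : b = 0 \/ b = 1 \/ b = 2 \/ 2 < b by lia.
  - by move=> b0; move: yE (@D2 i.+2); rewrite b0; lia.
  - by [].
  (* [2 * (c - 1)] exceeds [c], so it is the end degree 4 and [c = 3]; the bound at that end would
     read [26 <= 24]. *)
  - move=> b2; have [aE [dE DkE]] : a = 6 /\ d0 = 4 /\ D k = 4 by nia.
    by move: ekd; rewrite aE b2 dE => /(_ DkE).
  (* Now [b * (c - 1)] exceeds both [c] and [d0]. *)
  - move=> b3; have : 6 <= D i.+2 by nia.
    by case: d034 => ?; nia.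
subst b.
(* Otherwise [a = 5], the balance at 2 forces [D 1 = d0 = 3], and the bound at that end would read
   [16 <= 15]. *)
have c3 : D i.+1 <> 3.
  move=> c3; have /= := @Dint 2; have := @D2 3; case: d034 => dE; subst d0; lia.
(* As [c - 1] is neither 2 nor [c], both outer vertices are ends of degree [d0]. *)
have [i2 ex1] : i = 2 /\ D i.-1 = d0 by lia.
have [i2k ey1] : i.+2 = k /\ D i.+2 = d0 by lia.
subst i; move: Di Di1 ea ey1 ex1 yE => /=; rewrite i2k => *.
by split; split; lia.
Qed.

End Profile.

(** * Paths and cycles listed by an index *)

Section Walk.
Variables (H : sgraph) (u : nat -> H) (k : nat).
Hypothesis k4 : 4 <= k.
Local Notation R := [seq u i | i <- iota 1 k].

Lemma walkE : R = u 1 :: [seq u i | i <- iota 2 k.-1].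
Proof. by case: k k4. Qed.

Lemma walk_last : last (u 1) [seq u i | i <- iota 2 k.-1] = u k.
Proof.
rewrite (last_nth (u 1)) size_map size_iota -walkE.
rewrite (nth_map 0) ?size_iota; last lia.
by rewrite nth_iota; [congr u|]; lia.
Qed.

Lemma walk_adj : is_path R \/ is_cycle R ->
  forall i, 0 < i < k -> adj (u i) (u i.+1).
Proof.
move=> RP i ik.
have : path (@adj H) (u 1) [seq u i | i <- iota 2 k.-1].
  by move: RP; rewrite walkE /= => -[/andP[]|/and4P[]].
move/(pathP (u 1)) => /(_ i.-1); rewrite size_map size_iota -walkE.
rewrite !(nth_map 0) ?size_iota ?nth_iota; try lia.
by rewrite !addSn !add0n prednK; [apply|]; lia.
Qed.

(** Index 1 is left out because a cycle repeats [u 1] as [u k]. *)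
Lemma walk_tail_inj : is_path R \/ is_cycle R ->
  forall i j, 1 < i <= k -> 1 < j <= k -> i != j -> u i != u j.
Proof.
move=> RP i j ik jk ij.
have U : uniq [seq u i | i <- iota 2 k.-1].
  by move: RP; rewrite walkE /= => -[/and3P[]|/and4P[]].
have inj := nth_uniq (u 1) _ _ U; move: (inj (i - 2) (j - 2)).
rewrite size_map size_iota !(nth_map 0) ?size_iota ?nth_iota; try lia.
by rewrite !subnKC; [move=> ->| |]; lia.
Qed.

Lemma cycle_closed : is_cycle R -> u k = u 1.
Proof. by rewrite walkE /= walk_last => /and4P[_ /eqP]. Qed.

Lemma walk_nbrs_neq : is_path R \/ is_cycle R ->
  forall i, 0 < i -> i.+1 < k -> u i != u i.+2.
Proof.
move=> RP i i0 ik; have [i1|->] : 1 < i \/ i = 1 by lia.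
  by apply: (walk_tail_inj RP); lia.
case: (RP) => [|C]; last first.
  (* On a cycle [u 1] is [u k], and [k] differs from 3. *)
  by rewrite -(cycle_closed C); apply: (walk_tail_inj RP); lia.
rewrite walkE /= => /and3P[_ + _]; apply: contraNneq => ->.
by apply: map_f; rewrite mem_iota; lia.
Qed.

End Walk.

(** * The degree sequence of [R] *)

Theorem lemma6 (G : sgraph) (a b : nat) (HG : parabolic_bicyclic G a b)
  (k : nat) (u : nat -> del_pendant G) (R : seq (del_pendant G))
  (HR : R = [seq u i | i <- iota 1 k])
  (HRpc : is_path R \/ is_cycle R)
  (Hlen : 3 <= walk_length R)
  (Hends : deg (u 1) = deg (u k))
  (Hend34 : deg (u 1) = 3 \/ deg (u 1) = 4)
  (Hint : forall i : nat, 2 <= i <= k - 1 -> deg (u i) = 2) :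
  ((exists i : nat, 2 <= i <= k - 2 /\ deg (emb (u i)) <> deg (emb (u i.+1))) ->
     [/\ walk_length R = 3,
         b = 1,
         deg (u 1) = 3 ->
           [/\ a = 6, deg (emb (u 1)) = deg (u 1) &
               (deg (emb (u 2)) = 2 /\ deg (emb (u 3)) = 4) \/
               (deg (emb (u 2)) = 4 /\ deg (emb (u 3)) = 2)] &
         deg (u 1) = 4 ->
           [/\ a = 7, deg (emb (u 1)) = deg (u 1) &
               (deg (emb (u 2)) = 2 /\ deg (emb (u 3)) = 5) \/
               (deg (emb (u 2)) = 5 /\ deg (emb (u 3)) = 2)]])
  /\
  (forall d : nat,
     (forall i : nat, 2 <= i <= k - 1 -> deg (emb (u i)) = d) ->
     (d = 2 \/ (d%:Z = a%:Z - b%:Z - 1)%R) /\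
     (is_cycle R ->
        [/\ walk_length R = 3, deg (emb (u 2)) = 2 & deg (emb (u 3)) = 2])).

Proof.
have sR : walk_length R = k.-1 by rewrite /walk_length HR size_map size_iota.
have k4 : 4 <= k by lia.
move: HRpc; rewrite {1 2}HR => RP.
have uadj := walk_adj k4 RP.
pose D i := deg (emb (u i)).
have Dge i : 2 <= D i := emb_deg_ge2 HG (u i).
have Dint i : 1 < i < k ->
    D i = 2 /\ D i.-1 + D i.+1 + b + 4 = 2 * a \/
    2 < D i /\ D i + b + 1 = a /\ D i.-1 + D i.+1 + b = b * D i + 2.
  case: i => // i ik; apply: (emb_balance_deg2 HG).
  - by apply: Hint; lia.
  - by rewrite adj_sym; apply: uadj => /=; lia.
  - by apply: uadj; lia.
  - by apply: (walk_nbrs_neq k4 RP) => /=; lia.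
have Dend i : i = 1 \/ i = k ->
    [/\ deg (u 1) <= D i, deg (u 1) < D i -> D i + b + 1 = a &
        D i = deg (u 1) -> 2 * deg (u 1) + deg (u 1) ^ 2 + b <= a * deg (u 1)].
  have := emb_balance_ge HG (u i).
  by move=> + [] ik; rewrite ik ?Hends.
split=> [[i [ik neq]] | d Dd].
  have [H|H] :
      [/\ k = 4, b = 1 & a = deg (u 1) + 3] /\
        [/\ D 1 = deg (u 1), D k = deg (u 1), D 2 = 2 & D 3 = deg (u 1) + 1] \/
      [/\ k = 4, b = 1 & a = deg (u 1) + 3] /\
        [/\ D k = deg (u 1), D 1 = deg (u 1), D k.-1 = 2 &
            D k.-2 = deg (u 1) + 1].
  - have Di := Dint i; have Di1 := Dint i.+1.
    have [[e g]|[g e]] : (D i = 2 /\ 2 < D i.+1) \/ (2 < D i /\ D i.+1 = 2).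
    + by move: neq; rewrite -/(D i) -/(D i.+1); lia.
    + left.
      by apply: (profile_jump k4 Hend34 (fun i _ => Dge i) Dint Dend _ _ e g); lia.
    (* A drop from [c] to 2 at [i] is a rise from 2 to [c] at [k - i] in the reversed walk. *)
    right; pose D' j := D (k.+1 - j).
    have D'int j : 1 < j < k ->
        D' j = 2 /\ D' j.-1 + D' j.+1 + b + 4 = 2 * a \/
        2 < D' j /\ D' j + b + 1 = a /\
            D' j.-1 + D' j.+1 + b = b * D' j + 2.
      move=> jk; rewrite /D' [D _ + D _]addnC.
      have -> : k.+1 - j.+1 = (k.+1 - j).-1 by lia.
      have -> : k.+1 - j.-1 = (k.+1 - j).+1 by lia.
      by apply: Dint; lia.
    have D'end j : j = 1 \/ j = k ->
        [/\ deg (u 1) <= D' j, deg (u 1) < D' j -> D' j + b + 1 = a &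
            D' j = deg (u 1) ->
              2 * deg (u 1) + deg (u 1) ^ 2 + b <= a * deg (u 1)].
      by move=> jk; apply: Dend; lia.
    have := @profile_jump a b k (deg (u 1)) D' k4 Hend34
      (fun i _ => Dge _) D'int D'end (k - i).
    rewrite /D'; have -> : k.+1 - (k - i) = i.+1 by lia.
    have -> : k.+1 - (k - i).+1 = i by lia.
    have -> : k.+1 - k = 1 by lia.
    rewrite !subSS subn0 subn1 subn2.
    by apply=> //; lia.
  - case: H => -[kE b1 aE] [D1 _ D22 D3]; rewrite /D in D1 D22 D3.
    by split; [lia | | split; lia | split; lia].
  - case: H => -[kE b1 aE] [_ D1 D3 D22]; rewrite /D kE /= in D1 D22 D3.
    by split; [lia | | split; lia | split; lia].
have D2d : D 2 = d by apply: Dd; lia.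
have D3d : D 3 = d by apply: Dd; lia.
have I2 := Dint 2; have I3 := Dint 3.
split; first by lia.
rewrite [in X in X -> _]HR => C.
have closed := cycle_closed k4 C.
have [d2|d2] : d = 2 \/ d != 2 by lia.
  have [k4E|k5] : k = 4 \/ 4 < k by lia.
    by split; [lia | rewrite -/(D 2); lia | rewrite -/(D 3); lia].
  have D4d : D 4 = d by apply: Dd; lia.
  have [D1 _ _] := Dend 1 (or_introl erefl).
  (* Comparing the balances at 2 and 3 gives [D 1 = D 4 = 2], below the end degree. *)
  by move: I2 I3 => /=; lia.
exfalso.
have [D1 D1c _] := Dend 1 (or_introl erefl).
have DkE : D k = D 1 by rewrite /D closed.
have D41 : D 4 = d \/ D 4 = D 1.
  have [k4E|k5] : k = 4 \/ 4 < k by lia.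
    by right; rewrite -DkE k4E.
  by left; apply: Dd; lia.
(* The balance at 2 reads [D 1 + d + b = b * d + 2]. For [b <= 1] it makes [D 1] at most 1; for
   [2 < b] it makes [D 1] at least [2 * d - 1], above both [d] and 4. *)
have [b2 D1d] : b = 2 /\ D 1 = d.
  have : b <= 1 \/ b = 2 \/ 2 < b by lia.
  by case=> [|[]]; move: I2 I3 => /=; nia.
(* The cycle closes at [u 1], whose neighbours [u 2] and [u k.-1] share its degree [d] in [G]. *)
apply: (@no_two_nbrs_same_deg G a b HG (u 1) (u 2) (u k.-1)).
- by lia.
- by apply: uadj; lia.
- by rewrite -closed adj_sym -[in u k](@prednK k); [apply: uadj|]; lia.
- by apply: (walk_tail_inj k4 RP); lia.
- by [].
- by rewrite -/(D 1); move: I2 => /=; lia.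
- by rewrite -/(D 1) -/(D 2) D1d.
- by rewrite -/(D 1) -/(D k.-1) D1d; apply: Dd; lia.
Qed.
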